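(* Let $\boldsymbol\beta_2=(\beta_0,\beta_1,\beta_2)$ with $\beta_k\ge0$, $E=\mathcal{C}^{\boldsymbol\beta_2}(V;V)$, and let $\mathbf{W}=(W,\mathcal{W})\in\mathbf{C}^\alpha([0,T];E)$ be an $E$-valued (linear) rough path. Let $\mathbb{W}_{s,t}(x,y)=(\mathcal{D}^{(2)}\mathcal{W}_{s,t})(x,y)$, so that $(W,\mathbb{W})\in\mathbf{C}^{\alpha,\boldsymbol\beta_2}([0,T]\times V;V)$ is a nonlinear rough path. Let $(\widehat Y,\widehat Y')\in\widetilde{\mathcal{E}}^{2\alpha}_W$ be a basic controlled rough path with associated pair $(Y,\dot Y)\in\mathcal{E}^{2\alpha}_W$. Then, for all $0\le s\le t\le T$, the following two rough integrals coincide: $$\int_s^tW(dr,Y_r)=\int_s^t\widehat Y_r\,d\mathbf{W}_r,$$ where the left-hand side is the nonlinear rough integral and the right-hand side is the linear rough integral.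
   Context: Fix $T>0$, $\alpha\in(\frac13,\frac12]$ and a separable Banach space $V$; $\Phi_{s,t}:=\Phi_t-\Phi_s$ for functions of time; tensor products carry the projective norm. $\mathcal{C}^{\boldsymbol\beta_n}(V;V)$ is the Banach space of $n$ times continuously Fréchet differentiable $\phi:V\to V$ with $\|\phi\|_{\boldsymbol\beta_n}=\sum_{k=0}^n\sup_x\|D^k\phi(x)\|(1+\|x\|_V)^{-\beta_k}<\infty$. For a Banach space $E$, $\mathbf{C}^\alpha([0,T];E)$ is the set of pairs $(W,\mathcal{W})$ with $W:[0,T]\to E$ $\alpha$-Hölder, $\mathcal{W}:[0,T]^2\to E\otimes E$ with $\sup_{s\ne t}\|\mathcal{W}_{s,t}\|/|t-s|^{2\alpha}<\infty$ and $\mathcal{W}_{s,t}-\mathcal{W}_{s,u}-\mathcal{W}_{u,t}=W_{s,u}\otimes W_{u,t}$. $\mathcal{D}_W^{2\alpha}(K)$ is the set of pairs of $\alpha$-Hölder paths $H:[0,T]\to K$, $H':[0,T]\to\mathcal{L}(E;K)$ with $\sup_{s\ne t}\|H_{s,t}-H'_sW_{s,t}\|_K/|t-s|^{2\alpha}<\infty$. For $(H,H')\in\mathcal{D}_W^{2\alpha}(\mathcal{L}(E;V))$, with $H'_t(\phi_1\otimes\phi_2)=(H'_t\phi_1)(\phi_2)$, the linear rough integral is $\int_s^tH_rd\mathbf{W}_r=\lim_{|\pi|\to0}\sum_k[H_{t_{k-1}}W_{t_{k-1},t_k}+H'_{t_{k-1}}\mathcal{W}_{t_{k-1},t_k}]$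 over partitions of $[s,t]$. $\mathcal{D}^{(2)}$ is the continuous linear operator on $\mathcal{C}^{\boldsymbol\beta_n}(V;V)^{\otimes2}$ determined by $\mathcal{D}^{(2)}(\phi_1\otimes\phi_2)(x,y)=D\phi_2(y)(\phi_1(x))$. We also write $W(t,x)=W_t(x)$. $\mathbf{C}^{\alpha,\boldsymbol\beta_2}([0,T]\times V;V)$ is the set of pairs $(W,\mathbb{W})$ such that $W$ is twice continuously differentiable in $x$ with $\sum_{k=0}^2\sup_{s\ne t,x}\|D^kW_{s,t}(x)\||t-s|^{-\alpha}(1+\|x\|_V)^{-\beta_k}<\infty$, $\mathbb{W}:[0,T]^2\times V^2\to V$ is continuously differentiable in $(x,y)$ with $\sum_{k=0}^1\sup_{s\ne t,x,y}\|D^k\mathbb{W}_{s,t}(x,y)\||t-s|^{-2\alpha}(1+\|x\|_V)^{-\beta^*_k}(1+\|y\|_V)^{-\beta^{**}_k}<\infty$, where $\beta^*_0=\beta_0$, $\beta^*_1=\max\{\beta_0,\beta_1\}$, $\beta^{**}_0=\beta_1$, $\beta_1^{**}=\max\{\beta_1,\beta_2\}$, and $\mathbb{W}_{s,t}(x,y)-\mathbb{W}_{s,u}(x,y)-\mathbb{W}_{u,t}(x,y)=DW_{u,t}(y)(W_{s,u}(x))$. $\mathcal{E}_W^{2\alpha}$ is the set of pairs $(Y,\dot Y)$ of $\alpha$-Hölder paths $[0,T]\to V$ with $\sup_{s\ne t}\|Y_{s,t}-W_{s,t}(\dot Y_s)\|_V/|t-s|^{2\alpha}<\infty$; the nonlinear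 rough integral is $\int_s^tW(dr,Y_r)=\lim_{|\pi|\to0}\sum_k[W_{t_{k-1},t_k}(Y_{t_{k-1}})+\mathbb{W}_{t_{k-1},t_k}(\dot Y_{t_{k-1}},Y_{t_{k-1}})]$. $\widetilde{\mathcal{E}}_W^{2\alpha}$ (basic controlled rough paths) is the set of pairs $(\widehat Y,\widehat Y')\in\mathcal{D}_W^{2\alpha}(\mathcal{L}(E;V))$ for which there are $\alpha$-Hölder $Y,\dot Y:[0,T]\to V$ (the associated pair) with $\widehat Y_t(\phi)=\phi(Y_t)$ and $\widehat Y'_t(\phi_1,\phi_2)=D\phi_2(Y_t)(\phi_1(\dot Y_t))$ for all $t$ and $\phi,\phi_1,\phi_2\in E$. *)

(* Defs.v *)
From HB Require Import structures.
From mathcomp Require Import all_boot all_order all_algebra.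
From mathcomp Require Import all_classical all_reals all_analysis.

Set Implicit Arguments.
Unset Strict Implicit.
Unset Printing Implicit Defensive.

Import Order.TTheory GRing.Theory Num.Theory.
Import numFieldNormedType.Exports.

Local Open Scope classical_set_scope.
Local Open Scope ring_scope.

(* The space [blin U V] of continuous linear maps, with the operator norm. *)
Section BoundedLinear.
Context {R : realType} (U V : normedModType R).

Definition blin_pred : {pred U -> V} :=
  fun f => `[< linear f /\ continuous f >].

Record blin := Blin { blin_fun :> U -> V ; blinP : blin_fun \in blin_pred }.

HB.instance Definition _ := [isSub for blin_fun].
HB.instance Definition _ := [Choice of blin by <:].

Lemma blin_pred_submod : submod_closed blin_pred.
Proof.
split.
  apply/asboolP; split; last exact: (@cst_continuous U V 0).
  by move=> a u v; exact: esym (etrans (addr0 (a *: (0 : V))) (scaler0 V a)).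
move=> a f g /asboolP[lf cf] /asboolP[lg cg]; apply/asboolP; split.
  have E x : (a *: f + g) x = a *: f x + g x by [].
  move=> b u v; rewrite !E lf lg.
  by rewrite !scalerDr !scalerA (mulrC a b) addrACA.
by move=> x; apply: (@cvgD _ _ _ _ _ (fun y => a *: f y) g); [
  apply: cvgZr; exact: cf | exact: cg].
Qed.

HB.instance Definition _ :=
  GRing.isSubmodClosed.Build R (U -> V) blin_pred blin_pred_submod.
HB.instance Definition _ := [SubChoice_isSubLmodule of blin by <:].

Lemma blin_linear (f : blin) : linear f.
Proof. by have /asboolP[] := blinP f. Qed.

Lemma blin_continuous (f : blin) : continuous f.
Proof. by have /asboolP[] := blinP f. Qed.

HB.instance Definition _ (f : blin) :=
  GRing.isLinear.Build R U V *:%R (blin_fun f) (blin_linear f).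

Definition opnorm (f : blin) : R := sup [set `|f x| | x in [set x | `|x| <= 1]].

Lemma opnorm_has_sup (f : blin) :
  has_sup [set `|f x| | x in [set x | `|x| <= 1]].
Proof.
split; first by exists `|f 0|, 0 => //=; rewrite normr0 ler01.
have /linear_bounded_continuous/linear_boundedP := @blin_continuous f.
move=> /pinfty_ex_gt0[r r0 fr]; exists r => _ [x /= x1 <-].
by rewrite (le_trans (fr x))// ler_piMr// ltW.
Qed.

Lemma opnorm_ub (f : blin) x : `|x| <= 1 -> `|f x| <= opnorm f.
Proof. by move=> x1; apply: ub_le_sup; [case: (opnorm_has_sup f)|exists x]. Qed.

Lemma opnorm_le (f : blin) (C : R) :
  (forall x, `|x| <= 1 -> `|f x| <= C) -> opnorm f <= C.
Proof.
move=> fC; apply: ge_sup; first by case: (opnorm_has_sup f).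
by move=> _ [x /= x1 <-]; exact: fC.
Qed.

Lemma blin_norm (f : blin) x : `|f x| <= opnorm f * `|x|.
Proof.
have [->|x0] := eqVneq x 0; first by rewrite linear0 !normr0 mulr0.
have nx0 : 0 < `|x| by rewrite normr_gt0.
rewrite -ler_pdivrMr// mulrC -[X in X * _]gtr0_norm ?invr_gt0//.
rewrite -normrZ -linearZ; apply: opnorm_ub.
by rewrite normrZ gtr0_norm ?invr_gt0// mulVf ?gt_eqF.
Qed.

Lemma opnormD (f g : blin) : opnorm (f + g) <= opnorm f + opnorm g.
Proof.
apply: opnorm_le => x x1; apply: (le_trans (ler_normD (f x) (g x))).
by apply: lerD; exact: opnorm_ub.
Qed.

Lemma opnormZ_le (a : R) (f : blin) : opnorm (a *: f) <= `|a| * opnorm f.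
Proof.
apply: opnorm_le => x x1.
have -> : (a *: f) x = a *: f x by [].
by rewrite normrZ ler_wpM2l// opnorm_ub.
Qed.

Lemma opnormZ (a : R) (f : blin) : opnorm (a *: f) = `|a| * opnorm f.
Proof.
apply/eqP; rewrite eq_le opnormZ_le /=.
have [->|a0] := eqVneq a 0.
  rewrite normr0 mul0r; apply: (le_trans (normr_ge0 ((0 *: f) 0))).
  by apply: opnorm_ub; rewrite normr0.
rewrite -ler_pdivlMl ?normr_gt0// -normfV.
by rewrite -[X in opnorm X <= _](scalerK a0) opnormZ_le.
Qed.

Lemma opnorm0_eq0 (f : blin) : opnorm f = 0 -> f = 0.
Proof.
move=> f0; apply/val_inj/funext => x; apply/eqP; rewrite -normr_le0.
by apply: (le_trans (blin_norm f x)); rewrite f0 mul0r.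
Qed.

HB.instance Definition _ :=
  Lmodule_isNormed.Build R blin opnormD opnormZ opnorm0_eq0.

End BoundedLinear.

(* [iterD k f x] is the k-th Fréchet derivative of f at x, as an element of
   [multi X Z k] = L(X; L(X; ... L(X; Z))). *)
Section IteratedDerivative.
Context {R : realType} (X Z : normedModType R).

Fixpoint multi (k : nat) : normedModType R :=
  if k is k'.+1 then blin X (multi k') else Z.

(* 0 where f is not differentiable. *)
Definition fderiv (Y : normedModType R) (f : X -> Y) (x : X) : blin X Y :=
  insubd (0 : blin X Y) ('d f x : X -> Y).

Fixpoint iterD (k : nat) (f : X -> Z) : X -> multi k :=
  match k return X -> multi k with
  | 0 => f
  | k'.+1 => fderiv (iterD k' f)
  end.

Definition Cn (n : nat) (f : X -> Z) : Prop :=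
  (forall k x, (k < n)%N -> differentiable (iterD k f) x) /\
  continuous (iterD n f).

End IteratedDerivative.

Section FrechetLemmas.
Context {R : realType} (X Y : normedModType R).

Lemma fderivE (f : X -> Y) x : differentiable f x -> fderiv f x = 'd f x :> (X -> Y).
Proof.
move=> df; rewrite /fderiv -[LHS]/(val (insubd 0 ('d f x : X -> Y))) val_insubd.
rewrite (_ : _ \in _) //; apply/asboolP; split; last exact: diff_continuous.
exact: linearP.
Qed.

Lemma fderiv_cst0 (x : X) : fderiv (0 : X -> Y) x = 0.
Proof.
apply/val_inj; rewrite /= fderivE; last exact: (differentiable_cst (0 : Y)).
by rewrite (diff_cst (0 : Y)).
Qed.

Lemma fderivP (a : R) (f g : X -> Y) x :
  differentiable f x -> differentiable g x ->
  differentiable (a *: f + g) x /\ fderiv (a *: f + g) x = a *: fderiv f x + fderiv g x.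
Proof.
move=> df dg; have daf : differentiable (a *: f) x by exact: differentiableZ.
have d : differentiable (a *: f + g) x by exact: differentiableD.
split; first exact: d.
by apply/val_inj; rewrite [LHS](fderivE d) (diffD daf dg) (diffZ a df) -(fderivE df) -(fderivE dg).
Qed.

End FrechetLemmas.

(* [Cw w n]: the n times continuously Fréchet differentiable maps f : X -> Z
   with sum_(k <= n) sup_x |D^k f(x)| / w k x < oo, normed by that sum. *)
Section WeightedSpace.
Context {R : realType} (X Z : normedModType R).
Variables (w : nat -> X -> {posnum R}) (n : nat).

Definition wnorms (k : nat) (f : X -> Z) : set R :=
  range (fun x => `|iterD k f x| / (w k x)%:num).

Definition Cw_pred : {pred X -> Z} := fun f =>
  `[< Cn n f /\ forall k, (k <= n)%N -> has_ubound (wnorms k f) >].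

Record Cw := mkCw { Cw_fun :> X -> Z ; CwP : Cw_fun \in Cw_pred }.

HB.instance Definition _ := [isSub for Cw_fun].
HB.instance Definition _ := [Choice of Cw by <:].

Lemma iterD0 k : iterD k (0 : X -> Z) = 0.
Proof. by elim: k => //= k ->; apply/funext => x; exact: fderiv_cst0. Qed.

Lemma iterDP (a : R) (f g : X -> Z) (k : nat) : (k <= n)%N -> Cn n f -> Cn n g ->
  iterD k (a *: f + g) = a *: iterD k f + iterD k g.
Proof.
move=> kn [cf _] [cg _]; elim: k kn => //= k ih kn.
rewrite ih; last exact: ltnW.
by apply/funext => x; have [_ ->] := fderivP a (cf k x kn) (cg k x kn).
Qed.

Lemma wnorms_has_sup k (f : Cw) : (k <= n)%N -> has_sup (wnorms k f).
Proof.
move=> kn; split; first by exists (`|iterD k f 0| / (w k 0)%:num), 0.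
by have /asboolP[_] := CwP f; exact.
Qed.

Lemma Cw_pred_submod : submod_closed Cw_pred.
Proof.
split.
  apply/asboolP; split.
    split; last by rewrite iterD0; exact: cst_continuous.
    by move=> k x _; rewrite iterD0; exact: (differentiable_cst (0 : multi X Z k)).
  move=> k _; exists 0 => _ [x _ <-].
  by rewrite iterD0 /= normr0 mul0r.
move=> a f g /asboolP[Cf bf] /asboolP[Cg bg]; apply/asboolP; split.
  split.
    move=> k x kn; rewrite (iterDP a (ltnW kn) Cf Cg).
    by case: (fderivP a (Cf.1 k x kn) (Cg.1 k x kn)).
  rewrite (iterDP a (leqnn n) Cf Cg) => x.
  apply: (@cvgD _ _ _ _ _ (fun y => a *: iterD n f y) (iterD n g)).
    by apply: cvgZr; exact: Cf.2.
  exact: Cg.2.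
move=> k kn; have [A Af] := bf k kn; have [B Bg] := bg k kn.
exists (`|a| * A + B) => _ [x _ <-]; rewrite (iterDP a kn Cf Cg).
have -> : (a *: iterD k f + iterD k g) x = a *: iterD k f x + iterD k g x by [].
apply: (@le_trans _ _ ((`|a| * `|iterD k f x| + `|iterD k g x|) / (w k x)%:num)).
  by rewrite ler_pM2r// -normrZ ler_normD.
rewrite mulrDl -mulrA lerD//; first by rewrite ler_wpM2l//; apply: Af; exists x.
by apply: Bg; exists x.
Qed.

HB.instance Definition _ :=
  GRing.isSubmodClosed.Build R (X -> Z) Cw_pred Cw_pred_submod.
HB.instance Definition _ := [SubChoice_isSubLmodule of Cw by <:].

Definition wnorm (f : Cw) : R := \sum_(k < n.+1) sup (wnorms k f).

Lemma Cw_Cn (f : Cw) : Cn n f.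
Proof. by have /asboolP[] := CwP f. Qed.

Lemma wnorms_ub (f : Cw) k x : (k <= n)%N ->
  `|iterD k f x| / (w k x)%:num <= sup (wnorms k f).
Proof.
move=> kn; apply: ub_le_sup; last by exists x.
by case: (wnorms_has_sup f kn).
Qed.

Lemma wnorms_le (f : Cw) k C : (k <= n)%N ->
  (forall x, `|iterD k f x| / (w k x)%:num <= C) -> sup (wnorms k f) <= C.
Proof.
move=> kn fC; apply: ge_sup; first by case: (wnorms_has_sup f kn).
by move=> _ [x _ <-].
Qed.

Lemma wnorms_ge0 (f : Cw) k : (k <= n)%N -> 0 <= sup (wnorms k f).
Proof. by move=> kn; apply: le_trans (wnorms_ub f 0 kn); rewrite divr_ge0. Qed.

Lemma iterD_CwD k (f g : Cw) : (k <= n)%N ->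
  iterD k (f + g : Cw) = iterD k f + iterD k g.
Proof.
move=> kn; have := iterDP 1 kn (Cw_Cn f) (Cw_Cn g).
by rewrite !scale1r.
Qed.

Lemma iterD_CwZ k a (f : Cw) : (k <= n)%N -> iterD k (a *: f : Cw) = a *: iterD k f.
Proof.
move=> kn; have := iterDP a kn (Cw_Cn f) (Cw_Cn 0).
by rewrite iterD0 !addr0.
Qed.

Lemma wnormD (f g : Cw) : wnorm (f + g) <= wnorm f + wnorm g.
Proof.
rewrite /wnorm -big_split /=; apply: ler_sum => k _.
have kn : (k <= n)%N by rewrite -ltnS.
apply: (@wnorms_le (f + g) k _ kn) => x; rewrite (iterD_CwD f g kn).
apply: (@le_trans _ _ ((`|iterD k f x| + `|iterD k g x|) / (w k x)%:num)).
  by rewrite ler_pM2r// ler_normD.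
by rewrite mulrDl lerD// wnorms_ub.
Qed.

Lemma wnormZ_le (a : R) (f : Cw) : wnorm (a *: f) <= `|a| * wnorm f.
Proof.
rewrite /wnorm mulr_sumr; apply: ler_sum => k _.
have kn : (k <= n)%N by rewrite -ltnS.
apply: (@wnorms_le (a *: f) k _ kn) => x; rewrite (iterD_CwZ a f kn).
have -> : (a *: iterD k f) x = a *: iterD k f x by [].
by rewrite normrZ -mulrA ler_wpM2l// wnorms_ub.
Qed.

Lemma wnorm_ge0 (f : Cw) : 0 <= wnorm f.
Proof. by apply: sumr_ge0 => k _; apply: wnorms_ge0; rewrite -ltnS. Qed.

Lemma wnormZ (a : R) (f : Cw) : wnorm (a *: f) = `|a| * wnorm f.
Proof.
apply/eqP; rewrite eq_le wnormZ_le /=.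
have [->|a0] := eqVneq a 0; first by rewrite normr0 mul0r wnorm_ge0.
rewrite -ler_pdivlMl ?normr_gt0// -normfV.
by rewrite -[X in wnorm X <= _](scalerK a0) wnormZ_le.
Qed.

Lemma wnorm0_eq0 (f : Cw) : wnorm f = 0 -> f = 0.
Proof.
move=> /eqP; rewrite psumr_eq0; last first.
  by move=> k _; apply: wnorms_ge0; rewrite -ltnS.
move=> /allP/(_ ord0 (mem_index_enum _)) /= /eqP f0.
apply/val_inj/funext => x; apply/eqP; rewrite -normr_le0.
have := wnorms_ub f x (leq0n n); rewrite f0 pmulr_lle0//.
Qed.

HB.instance Definition _ :=
  Lmodule_isNormed.Build R Cw wnormD wnormZ wnorm0_eq0.

End WeightedSpace.

Section WeightedSpacesOverV.
Context {R : realType}.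
Implicit Type V : normedModType R.

Lemma growth_gt0 V (b : R) (x : V) : 0 < (1 + `|x|) `^ b.
Proof. by rewrite powR_gt0// ltr_pwDl. Qed.

Definition growth V (b : R) (x : V) : {posnum R} := PosNum (growth_gt0 b x).

(* C^{beta_n}(V;V); only beta 0, ..., beta n are used. *)
Definition Cbeta V (beta : nat -> R) (n : nat) : normedModType R :=
  Cw V (fun k (x : V) => growth (beta k) x) n.

Definition beta_star (beta : nat -> R) (k : nat) : R :=
  if k is 0 then beta 0 else Num.max (beta 0) (beta 1).

Definition beta_sstar (beta : nat -> R) (k : nat) : R :=
  if k is 0 then beta 1 else Num.max (beta 1) (beta 2).

(* The C^1 functions of (x, y) with the weights of the second level of a
   nonlinear rough path. *)
Definition Cbeta2 V (beta : nat -> R) : normedModType R :=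
  Cw V (fun k (z : V * V) => ((growth (beta_star beta k) z.1)%:num *
                              (growth (beta_sstar beta k) z.2)%:num)%:pos) 1.

Definition separable (T : topologicalType) : Prop :=
  exists A : set T, countable A /\ dense A.

End WeightedSpacesOverV.

Section ProjectiveTensor.
Context {R : realType}.

Definition tsum (E F : Type) (T : nmodType) (tens : E -> F -> T)
    (s : seq (E * F)) : T := \sum_(p <- s) tens p.1 p.2.

Definition bilinear_map (E F G : lmodType R) (B : E -> F -> G) : Prop :=
  (forall b, linear (fun a => B a b)) /\ (forall a, linear (B a)).

(* T, with (a, b) |-> tens a b, is the completed projective tensor product of
   E and F: the finite sums of pure tensors form the algebraic tensor product
   (a formal sum vanishes in T only if every bilinear map sends it to 0), T
   induces on them the projective norm, and they are dense in the Banach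
   space T. This determines (T, tens) up to a unique isometry. *)
Record is_projective_tensor (E F : normedModType R)
    (T : completeNormedModType R) (tens : E -> F -> T) : Prop := {
  ptens_bilinear : bilinear_map tens ;
  ptens_algebraic : forall (G : lmodType R) (B : E -> F -> G),
    bilinear_map B -> forall s, tsum tens s = 0 -> tsum B s = 0 ;
  ptens_norm : forall s, `|tsum tens s| =
    inf [set \sum_(p <- s') `|p.1| * `|p.2| |
      s' in [set s' | tsum tens s' = tsum tens s]] ;
  ptens_dense : dense (range (tsum tens)) }.

(* The continuous linear extension to T of a bilinear map on E x F. *)
Definition tens_ext (E F : normedModType R) (T : completeNormedModType R)
    (tens : E -> F -> T) (G : normedModType R) (B : E -> F -> G) : blin T G :=
  get [set L : blin T G | forall a b, L (tens a b) = B a b].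

Definition is_D2 (V : normedModType R) (beta : nat -> R)
    (TE : completeNormedModType R)
    (tens : Cbeta V beta 2 -> Cbeta V beta 2 -> TE)
    (D2 : blin TE (Cbeta2 V beta)) : Prop :=
  forall (phi1 phi2 : Cbeta V beta 2) (x y : V),
    D2 (tens phi1 phi2) (x, y) = fderiv phi2 y (phi1 x).

End ProjectiveTensor.

(* Paths are functions on R of which only the values on [0, Tm] matter. *)
Section RoughPaths.
Context {R : realType} (Tm alpha : R).

Definition incr (K : zmodType) (F : R -> K) (s t : R) : K := F t - F s.

(* sup_{s <> t in [0, Tm]} |A s t| / |t - s|^gamma < oo *)
Definition two_holder (K : normedModType R) (gamma : R) (A : R -> R -> K) : Prop :=
  exists C : R, forall s t, s \in `[0, Tm] -> t \in `[0, Tm] -> s != t ->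
    `|A s t| / `|t - s| `^ gamma <= C.

Definition holder (K : normedModType R) (F : R -> K) : Prop :=
  two_holder alpha (incr F).

Definition is_rough_path (E : normedModType R) (TE : completeNormedModType R)
    (tens : E -> E -> TE) (W : R -> E) (WW : R -> R -> TE) : Prop :=
  [/\ holder W, two_holder (2 * alpha) WW &
    forall s u t, s \in `[0, Tm] -> u \in `[0, Tm] -> t \in `[0, Tm] ->
      WW s t - WW s u - WW u t = tens (incr W s u) (incr W u t)].

Definition is_controlled (E K : normedModType R) (W : R -> E)
    (H : R -> K) (H' : R -> blin E K) : Prop :=
  [/\ holder H, holder H' &
    two_holder (2 * alpha) (fun s t => incr H s t - H' s (incr W s t))].

Definition is_nl_rough_path (V : normedModType R) (beta : nat -> R)
    (W : R -> V -> V) (WW : R -> R -> V * V -> V) : Prop :=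
  [/\ forall t, t \in `[0, Tm] -> Cn 2 (W t),
    forall k, (k <= 2)%N -> exists C : R, forall s t x,
      s \in `[0, Tm] -> t \in `[0, Tm] -> s != t ->
      `|iterD k (incr W s t) x| / `|t - s| `^ alpha /
        (1 + `|x|) `^ beta k <= C,
    forall s t, s \in `[0, Tm] -> t \in `[0, Tm] -> Cn 1 (WW s t),
    forall k, (k <= 1)%N -> exists C : R, forall s t x y,
      s \in `[0, Tm] -> t \in `[0, Tm] -> s != t ->
      `|iterD k (WW s t) (x, y)| / `|t - s| `^ (2 * alpha) /
        (1 + `|x|) `^ beta_star beta k / (1 + `|y|) `^ beta_sstar beta k <= C &
    forall s u t x y, s \in `[0, Tm] -> u \in `[0, Tm] -> t \in `[0, Tm] ->
      WW s t (x, y) - WW s u (x, y) - WW u t (x, y) =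
      fderiv (incr W u t) y (incr W s u x)].

Definition is_nl_controlled (V : normedModType R) (W : R -> V -> V)
    (Y Yd : R -> V) : Prop :=
  [/\ holder Y, holder Yd &
    two_holder (2 * alpha) (fun s t => incr Y s t - incr W s t (Yd s))].

Definition is_associated_pair (V : normedModType R) (beta : nat -> R)
    (Yh : R -> blin (Cbeta V beta 2) V)
    (Yh' : R -> blin (Cbeta V beta 2) (blin (Cbeta V beta 2) V))
    (Y Yd : R -> V) : Prop :=
  [/\ holder Y, holder Yd &
    forall t, t \in `[0, Tm] ->
      (forall phi : Cbeta V beta 2, Yh t phi = phi (Y t)) /\
      (forall phi1 phi2 : Cbeta V beta 2,
        Yh' t phi1 phi2 = fderiv phi2 (Y t) (phi1 (Yd t)))].

Definition is_basic_controlled (V : normedModType R) (beta : nat -> R)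
    (W : R -> Cbeta V beta 2)
    (Yh : R -> blin (Cbeta V beta 2) V)
    (Yh' : R -> blin (Cbeta V beta 2) (blin (Cbeta V beta 2) V)) : Prop :=
  is_controlled W Yh Yh' /\
  exists Y Yd : R -> V, is_associated_pair Yh Yh' Y Yd.

End RoughPaths.

Section RoughIntegrals.
Context {R : realType} (V : normedModType R).

(* A partition s = t_0 < t_1 < ... < t_n = t is the sequence
   p = [:: t_1; ...; t_n] with [itv_partition s t p]. *)
Definition steps (s : R) (p : seq R) : seq (R * R) := zip (s :: p) p.

Definition mesh (s : R) (p : seq R) : R :=
  \big[Num.max/0]_(q <- steps s p) (q.2 - q.1).

Definition mesh_filter (s t : R) : set_system (seq R) :=
  filter_from [set d : R | 0 < d]
    (fun d => [set p | itv_partition s t p /\ mesh s p < d]).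

Definition riemann_sum (Xi : R -> R -> V) (s : R) (p : seq R) : V :=
  \sum_(q <- steps s p) Xi q.1 q.2.

Definition rough_sum (E : normedModType R) (TE : completeNormedModType R)
    (tens : E -> E -> TE) (W : R -> E) (WW : R -> R -> TE)
    (H : R -> blin E V) (H' : R -> blin E (blin E V)) : R -> seq R -> V :=
  riemann_sum (fun u v => H u (incr W u v) +
                          tens_ext tens (fun a b => H' u a b) (WW u v)).

Definition nl_rough_sum (W : R -> V -> V) (WW : R -> R -> V * V -> V)
    (Y Yd : R -> V) : R -> seq R -> V :=
  riemann_sum (fun u v => incr W u v (Y u) + WW u v (Yd u, Y u)).

Definition rough_integral (E : normedModType R) (TE : completeNormedModType R)
    (tens : E -> E -> TE) (W : R -> E) (WW : R -> R -> TE)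
    (H : R -> blin E V) (H' : R -> blin E (blin E V)) (s t : R) : V :=
  lim (rough_sum tens W WW H H' s @ mesh_filter s t).

Definition nl_rough_integral (W : R -> V -> V) (WW : R -> R -> V * V -> V)
    (Y Yd : R -> V) (s t : R) : V :=
  lim (nl_rough_sum W WW Y Yd s @ mesh_filter s t).

End RoughIntegrals.

(* Main.v *)
Require Import Defs.
From HB Require Import structures.
From mathcomp Require Import all_boot all_order all_algebra.
From mathcomp Require Import all_classical all_reals all_analysis.
From mathcomp Require Import ring lra.

Set Implicit Arguments.
Unset Strict Implicit.
Unset Printing Implicit Defensive.

Import Order.TTheory GRing.Theory Num.Theory.
Import numFieldNormedType.Exports.

Local Open Scope classical_set_scope.
Local Open Scope ring_scope.

(** Both integrals are limits of Riemann sums, and the two sums agree term by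
    term. At first level, [Yh u] is evaluation at [Y u], so that
    [Yh u (W_{u,v}) = W_{u,v}(Y u)]. At second level, the map
    [th |-> (D2 th)(Yd u, Y u)] is continuous and linear on the tensor product
    and sends [phi1 (x) phi2] to [D phi2 (Y u) (phi1 (Yd u))], which is
    [Yh' u phi1 phi2]. Since finite sums of pure tensors are dense, this map is
    the only continuous extension of [Yh' u] ([blin_ptens_eq]), hence the one
    that occurs in the linear integral. It follows that the two integrals
    converge together and to the same limit.

    Convergence is proved for the linear integral ([rough_sum_cvg]). Chen's
    relation turns the additivity defect of the germ into products of increments
    whose Hölder exponents add up to [3 * alpha > 1] ([rough_germ_defect]); the
    projective norm is what bounds the extension of [H'_v - H'_u] to the tensor
    product by [|H'_v - H'_u|] ([blin_ptens_le]). The sewing lemma ([sewing])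
    then gives a limit along partitions of vanishing mesh.

    The nonlinear rough path bounds hold because [D2] is bounded, and its Chen
    relation is the image under [D2] of the linear one. *)

(** * Partitions and mesh *)

Section Partitions.
Context {R : realType}.
Implicit Types (s t u v d : R) (p q : seq R).

Lemma steps_cons s v p : steps s (v :: p) = (s, v) :: steps v p.
Proof. by []. Qed.

Lemma mesh_cons s v p : mesh s (v :: p) = Num.max (v - s) (mesh v p).
Proof. by rewrite /mesh steps_cons big_cons. Qed.

Lemma itv_partition_step_cons s t v p :
  s < v -> itv_partition v t p -> itv_partition s t (v :: p).
Proof. by move=> sv [pp lp]; split => //=; rewrite sv. Qed.

Lemma itv_partition_catP s t v p q :
  itv_partition s t (rcons p v ++ q) <->
  itv_partition s v (rcons p v) /\ itv_partition v t q.
Proof.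
rewrite /itv_partition cat_path last_cat !last_rcons eqxx.
split; first by move=> [/andP[? ?] ?].
by move=> [[-> _] [-> ->]].
Qed.

(** What makes [mesh_filter s t] a proper filter. *)
Lemma exists_partition_mesh_lt s t d : 0 < d -> s <= t ->
  exists2 p, itv_partition s t p & mesh s p < d.
Proof.
move=> d0 st.
have [n] : exists n, t - s <= n%:R * (d / 2).
  have d20 : 0 < d / 2 by rewrite divr_gt0.
  exists (Num.truncn ((t - s) / (d / 2))).+1.
  by rewrite -ler_pdivrMr// ltW// truncnS_gt.
(* each step peels off an interval of length d / 2 on the left *)
elim: n => [|n IH] in s st *.
  rewrite mul0r subr_le0 => ts; have -> : s = t by apply/le_anti/andP.
  by exists [::]; [split|rewrite /mesh big_nil].
move=> stn; have [ts|ts] := leP (t - s) (d / 2).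
  have [<-|st'] := eqVneq s t.
    by exists [::]; [split|rewrite /mesh big_nil].
  exists [:: t]; first by apply: itv_partition1; rewrite lt_neqAle st'.
  by rewrite mesh_cons /mesh big_nil gt_max d0 andbT; lra.
have [||p pP pd] := IH (s + d / 2); first by lra.
  by move: stn; rewrite -natr1 mulrDl mul1r; lra.
exists (s + d / 2 :: p); first by apply: itv_partition_step_cons => //; lra.
by rewrite mesh_cons gt_max pd andbT; lra.
Qed.

#[global] Instance mesh_filter_filter s t : Filter (mesh_filter s t).
Proof.
apply: filter_from_filter; first by exists 1 => /=; exact: ltr01.
move=> d e /= d0 e0; exists (Num.min d e); first by rewrite /= lt_min d0.
by move=> p [pst]; rewrite lt_min => /andP[pd pe].
Qed.

Lemma mesh_filter_proper s t : s <= t -> ProperFilter (mesh_filter s t).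
Proof.
move=> st; apply: filter_from_proper => d /= d0.
by have [p ? ?] := exists_partition_mesh_lt d0 st; exists p.
Qed.

(** Two partitions are compared in [sewing] through a partition that refines
    both of them. *)
Lemma common_refinement s t p q : itv_partition s t p -> itv_partition s t q ->
  exists r, [/\ itv_partition s t r, {subset p <= r} & {subset q <= r}].
Proof.
move=> pst qst; pose r := sort <=%O (undup (p ++ q)).
have rE : r =i p ++ q by move=> x; rewrite mem_sort mem_undup.
have pathr : path <%O s r.
  rewrite lt_path_sortedE sort_lt_sorted undup_uniq andbT.
  apply/allP => x; rewrite rE mem_cat => /orP[] xr.
    by have [/order_path_min-/(_ lt_trans)/allP/(_ _ xr)] := pst.
  by have [/order_path_min-/(_ lt_trans)/allP/(_ _ xr)] := qst.
exists r; split; [split => //|by move=> x xp; rewrite rE mem_cat xp|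
  by move=> x xq; rewrite rE mem_cat xq orbT].
have ler z : z \in s :: r -> z <= last s r.
  elim: r s pathr {pst qst rE} z => [|a r IH] s0 /=.
    by move=> _ z; rewrite inE => /eqP ->.
  move=> /andP[s0a par] z; rewrite inE => /predU1P[->|]; last exact: IH.
  by apply: le_trans (IH _ par a _); [exact: ltW|rewrite mem_head].
have tle x : x \in s :: p ++ q -> x <= t.
  have aux w : itv_partition s t w -> forall x, x \in s :: w -> x <= t.
    elim: w s {pathr pst qst ler} => [|a w IH] s0 ww z.
      by rewrite inE => /eqP ->; exact: itv_partition_le ww.
    rewrite inE => /predU1P[->|]; first exact: itv_partition_le ww.
    exact: IH (itv_partition_cons ww) z.
  rewrite inE mem_cat => /or3P[/eqP->|xp|xq].
  - exact: itv_partition_le pst.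
  - by apply: aux pst _ _; rewrite inE xp orbT.
  - by apply: aux qst _ _; rewrite inE xq orbT.
apply/eqP/le_anti/andP; split.
  by apply: tle; have := mem_last s r; rewrite !inE rE.
apply: ler; have [_ /eqP <-] := pst.
by have := mem_last s p; rewrite !inE rE mem_cat => /orP[->|->]; rewrite ?orbT.
Qed.

End Partitions.

(** * Riemann sums and the sewing lemma *)

Section RiemannSums.
Context {R : realType} {V : normedModType R}.
Implicit Types (Xi : R -> R -> V) (s t u v : R) (p q : seq R).

Lemma riemann_sum_nil Xi s : riemann_sum Xi s [::] = 0.
Proof. by rewrite /riemann_sum big_nil. Qed.

Lemma riemann_sum_cons Xi s v p :
  riemann_sum Xi s (v :: p) = Xi s v + riemann_sum Xi v p.
Proof. by rewrite /riemann_sum steps_cons big_cons. Qed.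

Lemma riemann_sum_cat Xi s p q :
  riemann_sum Xi s (p ++ q) = riemann_sum Xi s p + riemann_sum Xi (last s p) q.
Proof.
elim: p s => [|v p IH] s; first by rewrite riemann_sum_nil add0r.
by rewrite cat_cons !riemann_sum_cons IH addrA.
Qed.

Lemma eq_riemann_sum Xi1 Xi2 s t p : itv_partition s t p ->
  (forall u v, s <= u -> u <= v -> v <= t -> Xi1 u v = Xi2 u v) ->
  riemann_sum Xi1 s p = riemann_sum Xi2 s p.
Proof.
elim: p s => [|v p IH] s pst e; first by rewrite !riemann_sum_nil.
have sv : s <= v by case: pst => /= /andP[/ltW].
have pvt := itv_partition_cons pst; rewrite !riemann_sum_cons; congr (_ + _).
  by apply: e => //; exact: itv_partition_le pvt.
by apply: IH => // u w vu; apply: e; exact: le_trans vu.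
Qed.

End RiemannSums.

(** The germ [Xi] is additive on [a, b] up to a defect of order [theta > 1]. *)
Section Sewing.
Context {R : realType} {V : completeNormedModType R}.
Variables (Xi : R -> R -> V) (a b theta C : R).
Hypotheses (theta1 : 1 < theta) (C0 : 0 <= C)
  (defect : forall u v w, a <= u -> u <= v -> v <= w -> w <= b ->
    `|Xi u w - Xi u v - Xi v w| <= C * (w - u) `^ theta).
Implicit Types (u v d : R) (p q : seq R).

Let theta0 : 0 <= theta. Proof. by rewrite ltW// (lt_trans ltr01). Qed.

Lemma germ_diag0 u : a <= u -> u <= b -> Xi u u = 0.
Proof.
move=> au ub; apply/eqP; rewrite -normr_le0.
have := defect au (lexx u) (lexx u) ub.
rewrite (subrr u) powR0 ?gt_eqF ?(lt_trans ltr01)// mulr0.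
by rewrite subrr add0r normrN.
Qed.

(** Two intervals of half the length contribute [kappa < 1] times the
    contribution of the whole one; [theta > 1] makes this a contraction. *)
Let kappa : R := 2 * 2^-1 `^ theta.

Let kappa1 : kappa < 1.
Proof.
have -> : kappa = 2^-1 `^ (theta - 1).
  by rewrite /kappa -(@mulr_powRB1 _ 2^-1 theta) ?(lt_trans ltr01)// mulrA divff// mul1r.
rewrite /powR gt_eqF ?invr_gt0// -[ltRHS]expR0 ltr_expR nmulr_llt0 ?subr_gt0// lnV ?posrE// oppr_lt0.
by rewrite ln_gt0// ltr1n.
Qed.

(** The solution of [K = kappa * K + 2 * C], the recursion met in
    [sewing_estimate]. *)
Definition sewing_cst : R := 2 * C / (1 - kappa).
Local Notation K := sewing_cst.

Lemma sewing_cst_ge0 : 0 <= K.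
Proof. by rewrite divr_ge0 ?mulr_ge0// subr_ge0 ltW. Qed.

Let split_defect (A B ux uv xv xy yv : V) :
  A + (xy + B) - uv = (A - ux) + (B - yv) - (uv - ux - xv) - (xv - xy - yv).
Proof.
rewrite -{1}(subrK ux A) -{1}(subrK yv B) -{1}(subrK ux uv).
rewrite -{1}(subrK xv (uv - ux)) -{2}(subrK xy xv) -{1}(subrK yv (xv - xy)).
move: (A - ux) (B - yv) (uv - ux - xv) (xv - xy - yv) => a' b' d1 d2.
apply/eqP; rewrite subr_eq !addrA (addrAC _ (- d2) d1) !subrK; apply/eqP.
by rewrite [LHS](ACl (1*4*5*3*2)).
Qed.

(** Split the partition at its cell [x, y] that contains the midpoint of
    [u, v]. The parts on either side have at most half the length, so by
    induction on the number of points they contribute at most [kappa * K], and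
    reassembling the three pieces costs two defects, that is [2 * C]. *)
Lemma sewing_estimate u v p : a <= u -> v <= b -> itv_partition u v p ->
  `|riemann_sum Xi u p - Xi u v| <= K * (v - u) `^ theta.
Proof.
have [n] := ubnP (size p); elim: n => // n IH in u v p *.
move=> pn au vb puv; have uv := itv_partition_le puv.
have [uv_eq|u_neq_v] := eqVneq u v.
  rewrite -{v}uv_eq in puv uv vb *; rewrite (itv_partitionxx puv).
  by rewrite riemann_sum_nil germ_diag0// subrr normr0 mulr_ge0 ?powR_ge0 ?sewing_cst_ge0.
have ltuv : u < v by rewrite lt_neqAle u_neq_v.
pose m := (u + v) / 2.
have um : u < m by rewrite /m; lra.
have mv : m < v by rewrite /m; lra.
have hasp : has (> m) p.
  apply/hasP; exists v => //.
  have [_ /eqP lp] := puv; have := mem_last u p; rewrite lp inE => /predU1P[vu|//].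
  by rewrite vu ltxx in ltuv.
(* y is the first point of the partition beyond the midpoint, x the one before *)
case/split_find: hasp pn puv => y p1 p2 my p1m pn /itv_partition_catP[p1y p2v].
pose x := last u p1.
have p1x : itv_partition u x p1.
  by case: p1y; rewrite rcons_path => /andP[? _] _; split.
have xy : x < y by case: p1y; rewrite rcons_path => /andP[].
have xm : x <= m.
  have := mem_last u p1; rewrite -/x inE => /predU1P[->|xp1]; first exact: ltW.
  by rewrite leNgt; apply: contra p1m => mx; apply/hasP; exists x.
have ux := itv_partition_le p1x; have yv := itv_partition_le p2v.
rewrite size_cat size_rcons ltnS in pn.
have I1 : `|riemann_sum Xi u p1 - Xi u x| <= K * (x - u) `^ theta.
  apply: IH => //; last by lra.
  by apply: leq_trans pn; rewrite addSn ltnS leq_addr.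
have I2 : `|riemann_sum Xi y p2 - Xi y v| <= K * (v - y) `^ theta.
  apply: IH => //; last by lra.
  by apply: leq_trans pn; rewrite addSn ltnS leq_addl.
have half h : 0 <= h -> h <= (v - u) / 2 ->
    h `^ theta <= 2^-1 `^ theta * (v - u) `^ theta.
  move=> h0 hle; rewrite -powRM ?subr_ge0 ?(ltW ltuv)// ?invr_ge0//.
  by apply: ge0_ler_powR => //; rewrite ?nnegrE ?mulr_ge0 ?subr_ge0 ?invr_ge0// mulrC.
have E1 : (x - u) `^ theta <= 2^-1 `^ theta * (v - u) `^ theta.
  by apply: half; [lra|move: xm; rewrite /m; lra].
have E2 : (v - y) `^ theta <= 2^-1 `^ theta * (v - u) `^ theta.
  by apply: half; [lra|move: my; rewrite /m; lra].
have D1 : `|Xi u v - Xi u x - Xi x v| <= C * (v - u) `^ theta.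
  by apply: defect => //; lra.
have D2 : `|Xi x v - Xi x y - Xi y v| <= C * (v - u) `^ theta.
  apply: le_trans (defect _ _ _ _) _; [lra|lra|lra|lra|].
  rewrite ler_wpM2l//; apply: ge0_ler_powR => //; rewrite ?nnegrE; lra.
rewrite -cats1 -catA /= riemann_sum_cat riemann_sum_cons -/x.
rewrite (_ : _ - _ = (riemann_sum Xi u p1 - Xi u x) +
  (riemann_sum Xi y p2 - Xi y v) - (Xi u v - Xi u x - Xi x v)
  - (Xi x v - Xi x y - Xi y v)); last exact: split_defect.
have KE : K * kappa + 2 * C = K.
  have : 1 - kappa != 0 by rewrite subr_eq0 gt_eqF.
  by rewrite /K => ?; field.
do 2?[apply: le_trans (ler_normB _ _) _].
apply: (@le_trans _ _ (K * (2^-1 `^ theta * (v - u) `^ theta) +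
  K * (2^-1 `^ theta * (v - u) `^ theta) + C * (v - u) `^ theta + C * (v - u) `^ theta)).
  rewrite lerD//; apply: (le_trans (ler_normB _ _)); rewrite lerD//.
  apply: (le_trans (ler_normD _ _)).
  by rewrite lerD//; [apply: le_trans I1 _|apply: le_trans I2 _]; rewrite ler_wpM2l// sewing_cst_ge0.
by rewrite -{3}KE /kappa; lra.
Qed.

(** Apply [sewing_estimate] on each cell of the coarse partition [p]: the
    factor [(cell length)^(theta - 1)] is at most [d^(theta - 1)], and the
    remaining factors, the cell lengths, add up to [v - u]. *)
Lemma sewing_refinement d u v p q : a <= u -> v <= b ->
  itv_partition u v p -> itv_partition u v q -> {subset p <= q} -> mesh u p < d ->
  `|riemann_sum Xi u p - riemann_sum Xi u q| <= K * d `^ (theta - 1) * (v - u).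
Proof.
move=> + vb; elim: p u q => [|w p IH] u q au puv quv pq.
  move/itv_partition_nil: puv quv => -> /itv_partitionxx -> _.
  by rewrite subrr normr0 subrr mulr0.
rewrite mesh_cons gt_max => /andP[wud pd].
have uw : u < w by case: puv => /= /andP[].
have pwv := itv_partition_cons puv; have wv := itv_partition_le pwv.
have wq : w \in q by apply: pq; rewrite mem_head.
have qE : q = itv_partitionL q w ++ itv_partitionR q w.
  by apply: in_itv_partition => //; case: quv => /path_sorted.
have := quv; rewrite {1}qE => /itv_partition_catP[qL qR].
have pqR : {subset p <= itv_partitionR q w}.
  move=> x xp; rewrite mem_filter pq ?inE ?xp ?orbT// andbT.
  by case: puv => /= /andP[_ /order_path_min-/(_ lt_trans)/allP/(_ _ xp)].
have aw : a <= w by rewrite (le_trans au)// ltW.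
have J := IH w _ aw pwv qR pqR pd.
rewrite qE riemann_sum_cat /itv_partitionL last_rcons riemann_sum_cons.
rewrite opprD addrACA (le_trans (ler_normD _ _))//.
rewrite [leRHS](_ : _ = K * (d `^ (theta - 1) * (w - u)) +
  K * d `^ (theta - 1) * (v - w)); last by lra.
rewrite lerD// distrC (le_trans (sewing_estimate _ _ qL))// ?(le_trans wv)//.
rewrite ler_wpM2l ?sewing_cst_ge0//.
have wu0 : 0 <= w - u by rewrite subr_ge0 ltW.
rewrite -mulr_powRB1 ?(lt_trans ltr01)// mulrC ler_wpM2r//.
by apply: ge0_ler_powR; rewrite ?nnegrE ?subr_ge0 ?(ltW theta1)// ?ltW// (le_lt_trans wu0).
Qed.

(** By comparison with a common refinement, the Riemann sums over any two
    partitions of mesh less than [d] differ by [O(d^(theta - 1))], so they form a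
    Cauchy filter. *)
Lemma sewing : a <= b -> cvg (riemann_sum Xi a @ mesh_filter a b).
Proof.
move=> ab; have PF := mesh_filter_proper ab.
apply: cauchy_cvg; apply: cauchy_exP => e e0.
(* d is chosen so that d^(theta - 1) = c; the + 1 covers a = b and K = 0 *)
pose c := e / (2 * K * (b - a) + 1).
have Kab0 : 0 <= 2 * K * (b - a) 
  by rewrite mulr_ge0 ?subr_ge0// mulr_ge0// sewing_cst_ge0.
have c0 : 0 < c by rewrite divr_gt0// ltr_wpDl.
pose d := c `^ (theta - 1)^-1.
have d0 : 0 < d by rewrite powR_gt0.
have dE : d `^ (theta - 1) = c.
  rewrite -powRrM mulVf ?powRr1 ?(ltW c0)//.
  by rewrite subr_eq0 gt_eqF.
have [p0 p0P p0d] := exists_partition_mesh_lt d0 ab.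
exists (riemann_sum Xi a p0); exists d => // p [pP pd] /=.
have [r [rP pr p0r]] := common_refinement pP p0P.
have A1 := sewing_refinement (lexx a) (lexx b) pP rP pr pd.
have A2 := sewing_refinement (lexx a) (lexx b) p0P rP p0r p0d.
rewrite -ball_normE /=.
rewrite (_ : _ - _ = (riemann_sum Xi a p0 - riemann_sum Xi a r) -
  (riemann_sum Xi a p - riemann_sum Xi a r)); last by rewrite opprB addrA subrK.
apply: (le_lt_trans (ler_normB _ _)); apply: (le_lt_trans (lerD A2 A1)).
rewrite dE -mulrDr.
have -> : e = (2 * K * (b - a) + 1) * c.
  by rewrite /c mulrC divfK// gt_eqF// ltr_wpDl.
by rewrite mulrDl mul1r; lra.
Qed.

End Sewing.

(** * Bounded linear maps and evaluation *)

Section BoundedLinearMaps.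
Context {R : realType}.

Lemma bounded_linear_blin (U G : normedModType R) (f : U -> G) (M : R) :
  linear f -> (forall x, `|f x| <= M * `|x|) -> f \in @blin_pred R U G.
Proof.
move=> lf fM; apply/asboolP; split => //.
pose g : {linear U -> G} := HB.pack f (GRing.isLinear.Build R U G *:%R f lf).
apply: (@bounded_linear_continuous _ _ _ g); apply/linear_boundedP.
exists M; split; first exact: num_real.
by move=> r Mr x; rewrite (le_trans (fM x))// ler_wpM2r// ltW.
Qed.

Lemma Cw_norm_ub (X Z : normedModType R) (w : nat -> X -> {posnum R}) (n k : nat)
    (f : Cw Z w n) x :
  (k <= n)%N -> `|Defs.iterD k f x| <= `|f| * (w k x)%:num.
Proof.
move=> kn; rewrite -ler_pdivrMr//; apply: le_trans (wnorms_ub f x kn) _.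
have kn' : (k < n.+1)%N by rewrite ltnS.
rewrite [leRHS](bigD1 (Ordinal kn'))//= lerDl.
by apply: sumr_ge0 => i _; apply: wnorms_ge0; rewrite -ltnS.
Qed.

(** Point evaluation is bounded on a weighted space because the norm controls
    the values up to the weight. *)
Lemma Cw_eval_blin (U X Z : normedModType R) (w : nat -> X -> {posnum R})
    (n : nat) (L : blin U (Cw Z w n)) (x : X) :
  exists L' : blin U Z, forall u, L' u = L u x.
Proof.
have lx : linear (fun u => L u x).
  by move=> c u v; rewrite linearP.
have bx u : `|L u x| <= (opnorm L * (w 0%N x)%:num) * `|u|.
  rewrite (le_trans (Cw_norm_ub (L u) x (leq0n n)))// mulrAC ler_wpM2r//.
  exact: blin_norm.
by exists (Blin (bounded_linear_blin lx bx)).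
Qed.

End BoundedLinearMaps.

(** * Continuous linear maps on a projective tensor product *)

Section ProjectiveTensorMaps.
Context {R : realType} (E F : normedModType R) (T : completeNormedModType R).
Context (tens : E -> F -> T) (htens : is_projective_tensor tens).

(** A bound on pure tensors passes to a finite sum of them by the triangle
    inequality, for every way of writing that sum; the infimum over all of them
    is the projective norm. Density does the rest. *)
Lemma blin_ptens_le (G : normedModType R) (L : blin T G) (M : R) : 0 <= M ->
  (forall a b, `|L (tens a b)| <= M * (`|a| * `|b|)) ->
  forall x, `|L x| <= M * `|x|.
Proof.
move=> M0 LM x; apply/ler_addgt0Pr => e e0.
have oL : 0 <= opnorm L by exact: (normr_ge0 L).
(* One d goes into approximating x by a finite sum y, for a total cost of
   (M + opnorm L) * d, and another M * d into a nearly optimal decomposition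
   of y; the + 1 keeps the denominator positive. *)
pose d := e / (2 * M + opnorm L + 1).
have D0 : 0 < 2 * M + opnorm L + 1 by rewrite ltr_wpDl// addr_ge0// mulr_ge0.
have d0 : 0 < d by rewrite divr_gt0.
have [y [xy [s _ sy]]] : ball x d `&` range (tsum tens) !=set0.
  apply: (ptens_dense htens); last exact: ball_open.
  by exists x; exact: ballxx.
move: xy; rewrite -ball_normE /= => xy.
have [_ [s' /= s'y <-] s'd] : exists2 r : R,
    [set \sum_(p <- s') `|p.1| * `|p.2| |
      s' in [set s' | tsum tens s' = y]] r & r < `|y| + d.
  apply: inf_lt; first by eexists; exists s.
  by rewrite -sy -(ptens_norm htens) ltrDl.
have Ly : `|L y| <= M * (`|y| + d).
  apply: le_trans (ler_wpM2l M0 (ltW s'd)).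
  rewrite -s'y /tsum linear_sum mulr_sumr (le_trans (ler_norm_sum _ _ _))//.
  by apply: ler_sum => p _; exact: LM.
have yx : `|y| <= `|x| + d.
  rewrite -[y](subrK x) addrC (le_trans (ler_normD _ _))// lerD2l distrC.
  exact: ltW.
have Lxy : `|L (x - y)| <= opnorm L * d.
  by rewrite (le_trans (blin_norm _ _))// ler_wpM2l// ltW.
rewrite -[x in leLHS](subrK y) linearD (le_trans (ler_normD _ _))//.
have Myx := ler_wpM2l M0 yx.
have -> : e = (2 * M + opnorm L + 1) * d by rewrite /d mulrC divfK// gt_eqF.
by lra.
Qed.

Lemma blin_ptens_eq (G : normedModType R) (L1 L2 : blin T G) :
  (forall a b, L1 (tens a b) = L2 (tens a b)) -> L1 = L2.
Proof.
move=> L12; apply/eqP; rewrite -subr_eq0; apply/eqP/val_inj/funext => x /=.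
have /(_ x) : forall x, `|(L1 - L2) x| <= 0 * `|x|.
  apply: blin_ptens_le => // a b.
  have -> : (L1 - L2) (tens a b) = L1 (tens a b) - L2 (tens a b) by [].
  by rewrite L12 subrr normr0 mul0r.
by rewrite mul0r normr_le0 => /eqP.
Qed.

Lemma tens_extE (G : normedModType R) (B : E -> F -> G) (L : blin T G) :
  (forall a b, L (tens a b) = B a b) -> tens_ext tens B = L.
Proof.
move=> LB; apply: get_unique => // L' /= L'B.
by apply: blin_ptens_eq => a b; rewrite LB.
Qed.

End ProjectiveTensorMaps.

(** * Convergence of the linear rough integral *)

Section LinearRoughIntegral.
Context {R : realType} (Tm : R).

(** Vanishing on the diagonal lets the bound include [s = t], where the quotient
    in [two_holder] gives no information. *)
Lemma two_holder_le (K : normedModType R) (gamma : R) (A : R -> R -> K) :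
  two_holder Tm gamma A -> (forall s, s \in `[0, Tm] -> A s s = 0) ->
  exists2 C, 0 <= C & forall s t, 0 <= s -> s <= t -> t <= Tm ->
    `|A s t| <= C * (t - s) `^ gamma.
Proof.
move=> [C AC] A0; exists `|C| => // s t s0 st tT.
have sI : s \in `[0, Tm] by rewrite in_itv/= s0 (le_trans st).
have tI : t \in `[0, Tm] by rewrite in_itv/= tT (le_trans s0).
have [<-|s_neq_t] := eqVneq s t.
  by rewrite A0// normr0 mulr_ge0// powR_ge0.
have := AC s t sI tI s_neq_t.
have ts : 0 < t - s by rewrite subr_gt0 lt_neqAle s_neq_t.
rewrite (gtr0_norm ts) ler_pdivrMr ?powR_gt0// => /le_trans; apply.
by rewrite ler_wpM2r ?powR_ge0// ler_norm.
Qed.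

Context {alpha : R} {E : normedModType R} {TE V : completeNormedModType R}.
Context (tens : E -> E -> TE) (htens : is_projective_tensor tens).
Context (W : R -> E) (WW : R -> R -> TE).
Context (H : R -> blin E V) (H' : R -> blin E (blin E V)).

Let incrD (K : zmodType) (F : R -> K) s u t : incr F s t = incr F s u + incr F u t.
Proof. by rewrite /incr [RHS]addrC addrA subrK. Qed.

(** The term [H' u W_{u,v} W_{v,w}] produced by Chen's relation combines with
    [H_{u,v}] into the remainder of the controlled path. Both terms on the right
    are then of order [3 * alpha]: remainder ([2 * alpha]) times [W] ([alpha]), and
    increment of [H'] ([alpha]) times [WW] ([2 * alpha]). *)
Lemma rough_germ_defect (Lu Lv : blin TE V) u v w :
  WW u w - WW u v - WW v w = tens (incr W u v) (incr W v w) ->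
  (forall a b, Lu (tens a b) = H' u a b) ->
  (H u (incr W u w) + Lu (WW u w)) - (H u (incr W u v) + Lu (WW u v)) -
    (H v (incr W v w) + Lv (WW v w)) =
  - ((incr H u v - H' u (incr W u v)) (incr W v w) + (Lv - Lu) (WW v w)).
Proof.
move=> chen LuE.
have -> : (incr H u v - H' u (incr W u v)) (incr W v w) =
  H v (incr W v w) - H u (incr W v w) - H' u (incr W u v) (incr W v w) by [].
have -> : (Lv - Lu) (WW v w) = Lv (WW v w) - Lu (WW v w) by [].
have -> : H' u (incr W u v) (incr W v w) =
    Lu (WW u w) - Lu (WW u v) - Lu (WW v w) by rewrite -LuE -chen !linearB.
have -> : H u (incr W u w) = H u (incr W u v) + H u (incr W v w).
  by rewrite (incrD W u v w) linearD.
move: (H u _) (H u _) (H v _) (Lu _) (Lu _) (Lu _) (Lv _) => x y z p q r l.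
rewrite -(addrA y) [y + (x + r)]addrC addrKA !(opprD, opprK) !addrA.
by rewrite (addrAC _ (- p) (- l)) subrK [LHS](ACl (4*1*2*3*5)).
Qed.

(** The germ of the sums has a defect of order [3 * alpha > 1], so it can be
    sewn. The existence of extensions of [H' u] is assumed because [tens_ext] is a
    choice among them, about which nothing is known unless there is one. *)
Lemma rough_sum_cvg (s t : R) :
  3^-1 < alpha -> is_rough_path Tm alpha tens W WW ->
  is_controlled Tm alpha W H H' ->
  (forall u, u \in `[0, Tm] ->
    exists L : blin TE V, forall a b, L (tens a b) = H' u a b) ->
  0 <= s -> s <= t -> t <= Tm ->
  cvg (rough_sum tens W WW H H' s @ mesh_filter s t).
Proof.
move=> alpha3 [Wh WWh chen] [_ H'h Rh] ext s0 st tT.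
have inT u : 0 <= u -> u <= Tm -> u \in `[0, Tm] by move=> u0 uT; rewrite in_itv/= u0.
have incr0 (K : zmodType) (F : R -> K) u : incr F u u = 0 by exact: subrr.
pose L u : blin TE V := tens_ext tens (fun a b => H' u a b).
have extE u : u \in `[0, Tm] -> forall a b, L u (tens a b) = H' u a b.
  by move=> /ext[L' LE] a b; rewrite /L (tens_extE htens LE) LE.
have tens00 : tens 0 0 = 0.
  have [_ /(_ 0)ten0] := ptens_bilinear htens.
  by have := ten0 (-1) 0 0; rewrite scaler0 addr0 scaleN1r addNr.
(* Chen's relation at a single time *)
have WW0 u : u \in `[0, Tm] -> WW u u = 0.
  move=> uI; have := chen u u u uI uI uI.
  by rewrite subrr add0r incr0 tens00 => /eqP; rewrite oppr_eq0 => /eqP.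
have [CW CW0 CWP] := two_holder_le Wh (fun u _ => incr0 _ _ u).
have [CWW CWW0 CWWP] := two_holder_le WWh WW0.
have [CH CH0 CHP] := two_holder_le H'h (fun u _ => incr0 _ _ u).
have [|CR CR0 CRP] := two_holder_le Rh.
  by move=> u _; rewrite !incr0 linear0 subrr.
apply: (@sewing _ _ _ _ _ (3 * alpha) (CR * CW + CH * CWW)) => //.
- by lra.
- by rewrite addr_ge0// mulr_ge0.
move=> u v w su uv vw wt.
have u0 : 0 <= u by exact: le_trans su.
have v0 : 0 <= v by exact: le_trans uv.
have wT : w <= Tm by exact: le_trans tT.
have vT : v <= Tm by exact: le_trans wT.
have uI : u \in `[0, Tm] by rewrite inT// (le_trans uv).
have vI : v \in `[0, Tm] by rewrite inT.
have wI : w \in `[0, Tm] by rewrite inT// (le_trans v0).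
rewrite [X in `|X|](rough_germ_defect (L v) (chen u v w uI vI wI) (extE u uI)).
rewrite normrN.
have mono g h : 0 <= g -> 0 <= h -> h <= w - u -> h `^ g <= (w - u) `^ g.
  move=> g0 h0 hwu; apply: ge0_ler_powR => //; rewrite ?nnegrE//.
  exact: le_trans hwu.
have powE : (w - u) `^ (2 * alpha) * (w - u) `^ alpha = (w - u) `^ (3 * alpha).
  rewrite -powRD; last by apply/implyP => /eqP; lra.
  by congr (_ `^ _); lra.
rewrite (le_trans (ler_normD _ _))// mulrDl lerD//.
  rewrite (le_trans (blin_norm _ _))// -powE mulrACA.
  apply: ler_pM; [exact: (normr_ge0 (_ : blin E V))|exact: normr_ge0| |].
    rewrite (le_trans (CRP u v u0 uv vT))// ler_wpM2l// mono//; lra.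
  rewrite (le_trans (CWP v w v0 vw wT))// ler_wpM2l// mono//; lra.
have Lvu : `|(L v - L u) (WW v w)| <= `|incr H' u v| * `|WW v w|.
  apply: (blin_ptens_le htens) => // a b.
  have -> : (L v - L u) (tens a b) = incr H' u v a b.
    transitivity (L v (tens a b) - L u (tens a b)) => //.
    by rewrite (extE v vI) (extE u uI).
  rewrite (le_trans (blin_norm _ _))// mulrA ler_wpM2r//.
  exact: (blin_norm (incr H' u v) a).
rewrite (le_trans Lvu)// -powE [(w - u) `^ (2 * alpha) * _]mulrC mulrACA.
apply: ler_pM => //.
  rewrite (le_trans (CHP u v u0 uv vT))// ler_wpM2l// mono//; lra.
rewrite (le_trans (CWWP v w v0 vw wT))// ler_wpM2l// mono//; lra.
Qed.

End LinearRoughIntegral.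

(** * The nonlinear rough path and the comparison of the integrals *)

Section NonlinearRoughPath.
Context {R : realType} {Tm alpha : R} {V : completeNormedModType R}.
Context {beta : nat -> R} {TE : completeNormedModType R}.
Context {tens : Cbeta V beta 2 -> Cbeta V beta 2 -> TE}.
Context {D2 : blin TE (Cbeta2 V beta)} (hD2 : is_D2 tens D2).
Context {W : R -> Cbeta V beta 2} {WW : R -> R -> TE}.

Lemma rough_path_nl_rough_path : is_rough_path Tm alpha tens W WW ->
  is_nl_rough_path Tm alpha beta (fun t => W t) (fun s t => D2 (WW s t)).
Proof.
move=> [[CW CWP] [CWW CWWP] chen]; split.
- by move=> t _; exact: Cw_Cn.
- move=> k k2; exists CW => s t x sI tI s_neq_t.
  apply: le_trans (CWP s t sI tI s_neq_t).
  rewrite mulrAC ler_wpM2r ?invr_ge0 ?powR_ge0// ler_pdivrMr ?powR_gt0 ?ltr_pwDl//.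
  exact: (Cw_norm_ub (incr W s t) x k2).
- by move=> s t _ _; exact: Cw_Cn.
- move=> k k1; exists (opnorm D2 * CWW) => s t x y sI tI s_neq_t.
  have := ler_wpM2l (normr_ge0 D2) (CWWP s t sI tI s_neq_t).
  apply: le_trans.
  rewrite -mulrA -invfM mulrAC mulrA ler_wpM2r ?invr_ge0 ?powR_ge0//.
  rewrite ler_pdivrMr ?mulr_gt0 ?powR_gt0 ?ltr_pwDl//.
  apply: le_trans (Cw_norm_ub (D2 (WW s t)) (x, y) k1) _.
  by rewrite ler_wpM2r//; exact: blin_norm.
- move=> s u t x y sI uI tI.
  rewrite -[RHS](hD2 (incr W s u) (incr W u t)) -chen// !linearB.
  by [].
Qed.

(** The common source of the two second-level terms: [(D2 th)(x, y)] on one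
    side, the extension of [phi1, phi2 |-> D phi2 (y) (phi1 x)] on the other. *)
Lemma D2_extends (x y : V) : exists L : blin TE V,
  (forall th, L th = D2 th (x, y)) /\
  forall phi1 phi2, L (tens phi1 phi2) = fderiv phi2 y (phi1 x).
Proof.
have [L LE] := Cw_eval_blin D2 (x, y); exists L; split => // phi1 phi2.
by rewrite LE hD2.
Qed.

End NonlinearRoughPath.

Theorem theorem5p10 (R : realType) (Tm alpha : R) (V : completeNormedModType R)
    (beta : nat -> R)
    (hTm : 0 < Tm) (halpha : 3^-1 < alpha <= 2^-1)
    (hV : separable V) (hbeta : forall k, (k <= 2)%N -> 0 <= beta k)
    (TE : completeNormedModType R)
    (tens : Cbeta V beta 2 -> Cbeta V beta 2 -> TE)
    (htens : is_projective_tensor tens)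
    (D2 : blin TE (Cbeta2 V beta)) (hD2 : is_D2 tens D2)
    (W : R -> Cbeta V beta 2) (WW : R -> R -> TE)
    (hW : is_rough_path Tm alpha tens W WW)
    (Yh : R -> blin (Cbeta V beta 2) V)
    (Yh' : R -> blin (Cbeta V beta 2) (blin (Cbeta V beta 2) V))
    (hYh : is_basic_controlled Tm alpha W Yh Yh')
    (Y Yd : R -> V)
    (hYass : is_associated_pair Tm alpha Yh Yh' Y Yd)
    (hY : is_nl_controlled Tm alpha (fun t => W t : V -> V) Y Yd) :
  let Wfun : R -> V -> V := fun t => W t in
  let WWfun : R -> R -> V * V -> V := fun s t => D2 (WW s t) in
  is_nl_rough_path Tm alpha beta Wfun WWfun /\
  forall s t, 0 <= s -> s <= t -> t <= Tm ->
    [/\ cvg (nl_rough_sum Wfun WWfun Y Yd s @ mesh_filter s t),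
        cvg (rough_sum tens W WW Yh Yh' s @ mesh_filter s t) &
        nl_rough_integral Wfun WWfun Y Yd s t =
        rough_integral tens W WW Yh Yh' s t].
Proof.
move=> Wfun WWfun; split; first exact: rough_path_nl_rough_path.
move=> s t s0 st tT.
have [_ _ ass] := hYass.
have ext u : u \in `[0, Tm] -> exists L : blin TE V,
    (forall th, L th = D2 th (Yd u, Y u)) /\
    forall a b, L (tens a b) = Yh' u a b.
  move=> uI; have [L [LD LE]] := D2_extends hD2 (Yd u) (Y u).
  by exists L; split => // a b; rewrite LE (ass u uI).2.
have PF := mesh_filter_proper st.
have /andP[alpha3 _] := halpha.
have cv : cvg (rough_sum tens W WW Yh Yh' s @ mesh_filter s t).
  have [hctrl _] := hYh; apply: (rough_sum_cvg htens alpha3 hW hctrl) => //.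
  by move=> u /ext[L [_ LE]]; exists L.
have eq_sums p : itv_partition s t p ->
    nl_rough_sum Wfun WWfun Y Yd s p = rough_sum tens W WW Yh Yh' s p.
  move=> pst; apply: (eq_riemann_sum pst) => u v su uv vt.
  have uI : u \in `[0, Tm].
    by rewrite in_itv/= (le_trans s0 su)/= (le_trans uv)// (le_trans vt).
  have [L [LD LE]] := ext u uI.
  by rewrite (tens_extE htens LE) LD (ass u uI).1.
have near_eq : {near mesh_filter s t,
    rough_sum tens W WW Yh Yh' s =1 nl_rough_sum Wfun WWfun Y Yd s}.
  by exists 1 => /=; [exact: ltr01 | move=> p [/eq_sums ->]].
have lim_eq : nl_rough_sum Wfun WWfun Y Yd s @ mesh_filter s t -->
    lim (rough_sum tens W WW Yh Yh' s @ mesh_filter s t).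
  exact: cvg_trans (near_eq_cvg near_eq) cv.
split => //; first by apply/cvg_ex; eexists; exact: lim_eq.
exact: (cvg_lim (@norm_hausdorff _ V) lim_eq).
Qed.
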